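(* Let $n$ be a natural number, and let $1\leq a_1\leq\cdots\leq a_k$ with $k\geq 3$ and $1\leq b_1\leq\cdots\leq b_l$ with $l\geq 3$ be two partitions of $n$ (i.e. $\sum_i a_i=\sum_i b_i=n$). Then $$S(a_1,\dots,a_k)\prec S(b_1,\dots,b_l)\quad\Longleftrightarrow\quad (a_1,\dots,a_k)<^{\mathrm{lex}}(b_1,\dots,b_l).$$
   Context: For a graph $G$ and an integer $k\geq 0$, a walk of length $k$ is a sequence of vertices $v_0,\dots,v_k$ with $v_iv_{i+1}$ an edge for each $i$; it is closed if $v_0=v_k$. $M_k(G)$ denotes the total number of closed walks of length $k$ in $G$ (equivalently the trace of $A(G)^k$, $A(G)$ the adjacency matrix). For graphs $G,H$ write $G\preceq H$ if $M_k(G)\leq M_k(H)$ for all $k\geq 0$, and $G\prec H$ if $G\preceq H$ and $M_{k'}(G)<M_{k'}(H)$ for some $k'\geq 0$. For positive integers $a_1,\dots,a_k$, the starlike tree $S(a_1,\dots,a_k)$ is obtained from the disjoint paths $P_{a_1+1},\dots,P_{a_k+1}$ ($P_m$ the path on $m$ vertices) by identifying one end vertex of each path into a single vertex $u$ (the center), so that removing $u$ leaves paths $P_{a_1},\dots,P_{a_k}$ (the branches, of lengths $a_1,\dots,a_k$). Shortlex order: for finite sequences $a=(a_1,\dots,a_k)$ and $b=(b_1,\dots,b_l)$, $a<^{\mathrm{lex}}b$ if either $k<l$, or $k=l$ and $a_i<b_i$ for the smallest index $i$ with $a_i\neq b_i$. *)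

(* Defs.v *)
From mathcomp Require Import all_boot.
Set Implicit Arguments. Unset Strict Implicit. Unset Printing Implicit Defensive.

Definition closed_walks (T : finType) (e : rel T) (k : nat) : nat :=
  #|[pred w : {ffun 'I_k.+1 -> T} |
      (w ord0 == w ord_max) &&
      [forall i : 'I_k, e (w (widen_ord (leqnSn k) i)) (w (lift ord0 i))]]|.

Definition walk_le (T1 T2 : finType) (e1 : rel T1) (e2 : rel T2) : Prop :=
  forall k, closed_walks e1 k <= closed_walks e2 k.
Definition walk_lt (T1 T2 : finType) (e1 : rel T1) (e2 : rel T2) : Prop :=
  walk_le e1 e2 /\ exists k, closed_walks e1 k < closed_walks e2 k.

(* Starlike tree S(a_1,...,a_k): vertices 0..n where n = a_1+...+a_k;
   vertex 0 is the center u, and branch i (0-based) consists of the vertices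
   s_i, s_i+1, ..., s_i + a_i - 1 with s_i = a_1+...+a_{i} + 1 (the first i
   entries), forming a path attached to u at s_i. *)
Definition branch_starts (a : seq nat) : seq nat :=
  [seq sumn (take i a) + 1 | i <- iota 0 (size a)].

Definition star_edge0 (a : seq nat) (u v : nat) : bool :=
  ((u == 0) && (v \in branch_starts a)) ||
  [&& v == u.+1, u != 0 & v \notin branch_starts a].

Definition star_vert (a : seq nat) := 'I_(sumn a).+1.

Arguments star_edge0 : clear implicits.
Definition star_rel (a : seq nat) : rel (star_vert a) :=
  fun u v => star_edge0 a u v || star_edge0 a v u.

Fixpoint lex_lt (a b : seq nat) : bool :=
  match a, b with
  | x :: a', y :: b' => (x < y) || ((x == y) && lex_lt a' b')
  | _, _ => false
  end.

Definition shortlex_lt (a b : seq nat) : Prop :=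
  (size a < size b) \/ (size a = size b /\ lex_lt a b).
Arguments star_rel a : clear implicits.

(* Main.v *)
From HB Require Import structures.
From mathcomp Require Import all_boot all_order all_algebra.
From mathcomp Require Import boolp ring zify.
Require Import Defs.
Set Implicit Arguments. Unset Strict Implicit. Unset Printing Implicit Defensive.

(** Let [Phi_T = det (I - xA(T))] as a power series in [x]. Then
    [- Phi_T' / Phi_T = sum_k M_(k+1)(T) x^k], so [T] precedes [T'] as soon as
    [log (Phi_T / Phi_T')] has non-negative coefficients. For a starlike tree,
    [Phi = prod_i p_(a_i) * (1 - x^2 sum_i G_(a_i))], where [p_m] belongs to the
    path on [m] vertices and [G_m = p_(m-1) / p_m].

    Padding the shorter sequence with zeros in front (which does not change
    [Phi]) turns the shortlex order into the lexicographic order. Beyond the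
    common prefix, the key comparison is between [(c, x_1, ..., x_k)] with all
    [x_i > c] and [(c+1, ..., c+1, d)]. The quotient of the two [Phi] is the
    quotient for the disjoint unions of paths [(x_1, ..., x_k)] and
    [(c+1, ..., c+1, d+1)], times [1 - x^2 Z] for an explicit series [Z] with
    non-negative coefficients. The case [k = 1] is a balancing step
    [(c, x) -> (c+1, x-1)], and such steps settle the remaining comparisons. *)

Import Order.TTheory GRing.Theory Num.Theory.
Local Open Scope ring_scope.

(** * Formal power series with integer coefficients *)

Definition fps := nat -> int.
HB.instance Definition _ := gen_eqMixin fps.
HB.instance Definition _ := gen_choiceMixin fps.

Lemma fpsP (f g : fps) : (forall n, f n = g n) -> f = g.
Proof. by move=> fg; apply/funext. Qed.

Definition fps_trunc (N : nat) (f : fps) : {poly int} := \poly_(i < N.+1) f i.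

Definition fps_const (c : int) : fps := fun n => if n is 0%N then c else 0.
Definition fps_add (f g : fps) : fps := fun n => f n + g n.
Definition fps_opp (f : fps) : fps := fun n => - f n.
Definition fps_mul (f g : fps) : fps := fun n => \sum_(i < n.+1) f i * g (n - i)%N.

Lemma coef_trunc (N : nat) (f : fps) (n : nat) :
  (n <= N)%N -> (fps_trunc N f)`_n = f n.
Proof. by move=> le_nN; rewrite coef_poly ltnS le_nN. Qed.

(** A coefficient of a product depends only on truncations, so the ring laws of series are inherited
    from [{poly int}]. *)
Lemma fps_mulE (N : nat) (f g : fps) (n : nat) : (n <= N)%N ->
  fps_mul f g n = (fps_trunc N f * fps_trunc N g)`_n.
Proof.
move=> le_nN; rewrite coefM; apply: eq_bigr => i _.
by rewrite !coef_trunc // (leq_trans _ le_nN) ?leq_subr // -ltnS.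
Qed.

Fact fps_addA : associative fps_add.
Proof. by move=> f g h; apply: fpsP => n; rewrite /fps_add addrA. Qed.
Fact fps_addC : commutative fps_add.
Proof. by move=> f g; apply: fpsP => n; rewrite /fps_add addrC. Qed.
Fact fps_add0 : left_id (fps_const 0) fps_add.
Proof. by move=> f; apply: fpsP => -[|n]; rewrite /fps_add add0r. Qed.
Fact fps_addN : left_inverse (fps_const 0) fps_opp fps_add.
Proof. by move=> f; apply: fpsP => -[|n]; rewrite /fps_add addNr. Qed.
HB.instance Definition _ :=
  GRing.isZmodule.Build fps fps_addA fps_addC fps_add0 fps_addN.

Fact fps_mulA : associative fps_mul.
Proof.
move=> f g h; apply: fpsP => n.
transitivity ((fps_trunc n f * (fps_trunc n g * fps_trunc n h))`_n).
  rewrite coefM; apply: eq_bigr => i _.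
  by rewrite coef_trunc -1?ltnS // (@fps_mulE n) ?leq_subr.
rewrite mulrA coefM; apply: eq_bigr => i _.
by rewrite (@coef_trunc n) ?leq_subr // (@fps_mulE n) // -ltnS.
Qed.
Fact fps_mulC : commutative fps_mul.
Proof. by move=> f g; apply: fpsP => n; rewrite !(@fps_mulE n) // mulrC. Qed.
Fact fps_mul1 : left_id (fps_const 1) fps_mul.
Proof.
move=> f; apply: fpsP => n; rewrite /fps_mul big_ord_recl /= mul1r subn0.
by rewrite big1 ?addr0 // => i _; rewrite mul0r.
Qed.
Fact fps_mulDl : left_distributive fps_mul fps_add.
Proof.
move=> f g h; apply: fpsP => n; rewrite /fps_mul /fps_add -big_split /=.
by apply: eq_bigr => i _; rewrite mulrDl.
Qed.
Fact fps_nontrivial : fps_const 1 != fps_const 0.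
Proof. by apply/eqP => /(congr1 (fun f : fps => f 0%N)). Qed.
HB.instance Definition _ := GRing.Zmodule_isComNzRing.Build fps
  fps_mulA fps_mulC fps_mul1 fps_mulDl fps_nontrivial.

Lemma fpsD (f g : fps) (n : nat) : (f + g) n = f n + g n. Proof. by []. Qed.
Lemma fpsN (f : fps) (n : nat) : (- f) n = - f n. Proof. by []. Qed.
Lemma fpsM (f g : fps) (n : nat) :
  (f * g) n = \sum_(i < n.+1) f i * g (n - i)%N.
Proof. by []. Qed.
Lemma fps0 (n : nat) : (0 : fps) n = 0. Proof. by case: n. Qed.
Lemma fps1 (n : nat) : (1 : fps) n = (n == 0)%:R. Proof. by case: n. Qed.
Lemma fps_sum (I : Type) (s : seq I) (P : pred I) (F : I -> fps) (n : nat) :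
  (\sum_(i <- s | P i) F i) n = \sum_(i <- s | P i) F i n.
Proof. by apply: (big_morph (fun f : fps => f n)) => [//|]; exact: fps0. Qed.

Definition fps_X : fps := fun n => (n == 1)%:R.

Lemma fps_XM (f : fps) (n : nat) : (fps_X * f) n = if n is m.+1 then f m else 0.
Proof.
rewrite fpsM; case: n => [|n]; first by rewrite big_ord1 mul0r.
rewrite big_ord_recl mul0r add0r big_ord_recl mul1r /= subSS subn0.
by rewrite big1 ?addr0 // => i _; rewrite mul0r.
Qed.

Definition fps_D (f : fps) : fps := fun n => f n.+1 *+ n.+1.

Lemma fps_DD (f g : fps) : fps_D (f + g) = fps_D f + fps_D g.
Proof. by apply: fpsP => n; rewrite /fps_D fpsD mulrnDl. Qed.
Lemma fps_DN (f : fps) : fps_D (- f) = - fps_D f.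
Proof. by apply: fpsP => n; rewrite /fps_D fpsN mulNrn. Qed.
Lemma fps_D0 : fps_D 0 = 0.
Proof. by apply: fpsP => n; rewrite /fps_D !fps0 mul0rn. Qed.
Lemma fps_D1 : fps_D 1 = 0.
Proof. by apply: fpsP => n; rewrite /fps_D fps1 fps0 mul0rn. Qed.
Lemma fps_DX : fps_D fps_X = 1.
Proof. by apply: fpsP => -[|n]; rewrite /fps_D /fps_X fps1 ?mul0rn. Qed.
Lemma fps_DM (f g : fps) : fps_D (f * g) = fps_D f * g + f * fps_D g.
Proof.
apply: fpsP => n.
have tD (h : fps) i : (i <= n)%N ->
    ((fps_trunc n.+1 h)^`())`_i = (fps_trunc n (fps_D h))`_i.
  by move=> le_in; rewrite coef_deriv !coef_trunc.
have tT (h : fps) i : (i <= n)%N ->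
    (fps_trunc n.+1 h)`_i = (fps_trunc n h)`_i.
  by move=> le_in; rewrite !coef_trunc // leqW.
have -> : fps_D (f * g) n = ((fps_trunc n.+1 f * fps_trunc n.+1 g)^`())`_n.
  by rewrite coef_deriv -fps_mulE.
rewrite derivM coefD fpsD; congr (_ + _); rewrite coefM; apply: eq_bigr => i _;
  by rewrite ?tD ?tT ?coef_trunc ?leq_subr // -ltnS.
Qed.

Lemma fps_D_sum (I : finType) (P : pred I) (F : I -> fps) :
  fps_D (\sum_(i | P i) F i) = \sum_(i | P i) fps_D (F i).
Proof. exact: (big_morph fps_D fps_DD fps_D0). Qed.

Lemma fps_D_prod (I : finType) (F : I -> fps) :
  fps_D (\prod_i F i) = \sum_i fps_D (F i) * \prod_(j | j != i) F j.
Proof.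
suff H (s : seq I) : uniq s -> fps_D (\prod_(i <- s) F i) =
    \sum_(i <- s) fps_D (F i) * \prod_(j <- s | j != i) F j.
  by rewrite -[X in fps_D X]big_enum -big_enum H ?enum_uniq //=;
     apply: eq_bigr => i _; rewrite big_enum_cond.
elim: s => [|i s IH] /= => [_|/andP[i_s uniq_s]].
  by rewrite !big_nil fps_D1.
rewrite !big_cons eqxx /= fps_DM IH // mulr_sumr; congr (_ * _ + _).
  rewrite big_seq [RHS]big_seq_cond; apply: eq_bigl => j.
  by case: (boolP (j \in s)) => // js; rewrite (memPn i_s).
rewrite big_seq [RHS]big_seq; apply: eq_bigr => j js.
by rewrite big_cons eq_sym (memPn i_s) // mulrCA.
Qed.

(** The first [n] coefficients of the solution of [h = 1 + X f h]. Each coefficient needs all the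
    earlier ones, hence the list. *)
Fixpoint fps_inv_list (f : fps) (n : nat) : seq int :=
  if n is m.+1 then
    let s := fps_inv_list f m in
    rcons s ((m == 0)%:R + \sum_(i < m) f i * s`_(m.-1 - i))
  else [::].

(** The inverse of [1 - fps_X * f]. *)
Definition fps_star (f : fps) : fps := fun n => (fps_inv_list f n.+1)`_n.

Lemma size_inv_list (f : fps) (n : nat) : size (fps_inv_list f n) = n.
Proof. by elim: n => //= n IH; rewrite size_rcons IH. Qed.

Lemma nth_inv_list (f : fps) (n i : nat) :
  (i < n)%N -> (fps_inv_list f n)`_i = fps_star f i.
Proof.
elim: n => // n IH; rewrite ltnS leq_eqVlt => /predU1P[->//|lt_in].
by rewrite /= nth_rcons size_inv_list lt_in IH.
Qed.

Lemma fps_starE (f : fps) : fps_star f = 1 + fps_X * (f * fps_star f).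
Proof.
apply: fpsP => n; rewrite fpsD fps_XM fps1 {1}/fps_star [fps_inv_list _ _]/=.
rewrite nth_rcons size_inv_list ltnn eqxx; congr (_ + _).
case: n => [|n]; first by rewrite big_ord0.
rewrite fpsM; apply: eq_bigr => i _.
by rewrite nth_inv_list // ltnS leq_subr.
Qed.

Lemma fps_starK (f : fps) : (1 - fps_X * f) * fps_star f = 1.
Proof. by rewrite mulrBl mul1r {1}fps_starE; ring. Qed.

(** * Non-negative series and the order by logarithms *)

Definition fps_ge0 (f : fps) := forall n, 0 <= f n.
Definition fps_gt0 (f : fps) := fps_ge0 f /\ exists n, 0 < f n.

Lemma fps_ge0D (f g : fps) : fps_ge0 f -> fps_ge0 g -> fps_ge0 (f + g).
Proof. by move=> f0 g0 n; rewrite fpsD addr_ge0. Qed.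
Lemma fps_ge0M (f g : fps) : fps_ge0 f -> fps_ge0 g -> fps_ge0 (f * g).
Proof. by move=> f0 g0 n; rewrite fpsM sumr_ge0 // => i _; rewrite mulr_ge0. Qed.
Lemma fps_ge0_0 : fps_ge0 0. Proof. by move=> n; rewrite fps0. Qed.
Lemma fps_gt0_X : fps_gt0 fps_X.
Proof. by split; [move=> n; rewrite ler0n | exists 1%N]. Qed.
Lemma fps_ge0_X : fps_ge0 fps_X. Proof. exact: fps_gt0_X.1. Qed.
Lemma fps_ge0_sum (I : Type) (s : seq I) (P : pred I) (F : I -> fps) :
  (forall i, P i -> fps_ge0 (F i)) -> fps_ge0 (\sum_(i <- s | P i) F i).
Proof. by move=> F0; apply: big_ind => //; [exact: fps_ge0_0|exact: fps_ge0D]. Qed.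

Lemma fps_gt0D (f g : fps) : fps_gt0 f -> fps_ge0 g -> fps_gt0 (f + g).
Proof.
move=> [f0 [n fn]] g0; split; first exact: fps_ge0D.
by exists n; rewrite fpsD ltr_pwDl.
Qed.

Lemma fps_gt0M (f g : fps) : fps_gt0 f -> fps_gt0 g -> fps_gt0 (f * g).
Proof.
move=> [f0 [m fm]] [g0 [n gn]]; split; first exact: fps_ge0M.
exists (m + n)%N; rewrite fpsM (bigD1 (inord m)) //= inordK ?ltnS ?leq_addr //.
rewrite addKn ltr_pwDl ?mulr_gt0 //.
by rewrite sumr_ge0 // => i _; rewrite mulr_ge0.
Qed.

Lemma fps_ge0_star (f : fps) : fps_ge0 f -> fps_ge0 (fps_star f).
Proof.
move=> f0 n; elim/ltn_ind: n => n IH.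
rewrite fps_starE fpsD fps1 fps_XM; case: n IH => // n IH.
rewrite add0r fpsM sumr_ge0 // => i _.
by rewrite mulr_ge0 // IH // ltnS leq_subr.
Qed.

Lemma fps_gt0_star (f : fps) : fps_ge0 f -> fps_gt0 (fps_star f).
Proof.
move=> f0; split; first exact: fps_ge0_star.
by exists 0%N; rewrite fps_starE fpsD fps1 fps_XM.
Qed.

Lemma fps_ge0_DX (f : fps) : fps_ge0 f -> fps_ge0 (fps_D (fps_X * f)).
Proof. by move=> f0 n; rewrite /fps_D fps_XM mulrn_wge0. Qed.

Lemma fps_gt0_DX (f : fps) : fps_gt0 f -> fps_gt0 (fps_D (fps_X * f)).
Proof.
move=> [f0 [n fn]]; split; first exact: fps_ge0_DX.
by exists n; rewrite /fps_D fps_XM pmulrn_lgt0.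
Qed.

(** [log (f / g)] has non-negative coefficients; [S] is the condition on its
    derivative [h], so that [S := fps_gt0] makes the comparison strict. *)
Definition log_ge_by (S : fps -> Prop) (f g : fps) :=
  exists w h, [/\ S h, fps_D w = - (h * w) & g = f * w].
Notation log_ge := (log_ge_by fps_ge0).
Notation log_gt := (log_ge_by fps_gt0).

Lemma log_ge_refl (f : fps) : log_ge f f.
Proof.
exists 1, 0; split; [exact: fps_ge0_0 | by rewrite fps_D1 mul0r oppr0 |].
by rewrite mulr1.
Qed.

Lemma log_geM (S : fps -> Prop) (f1 g1 f2 g2 : fps) :
  (forall f g, S f -> fps_ge0 g -> S (f + g)) ->
  log_ge_by S f1 g1 -> log_ge f2 g2 -> log_ge_by S (f1 * f2) (g1 * g2).
Proof.
move=> SD [w1 [h1 [h1_0 dw1 ->]]] [w2 [h2 [h2_0 dw2 ->]]].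
exists (w1 * w2), (h1 + h2); split; [exact: SD | | ring].
by rewrite fps_DM dw1 dw2; ring.
Qed.

Lemma log_ge_trans (S : fps -> Prop) (f g k : fps) :
  (forall f g, S f -> fps_ge0 g -> S (f + g)) ->
  log_ge_by S f g -> log_ge g k -> log_ge_by S f k.
Proof.
move=> SD [w1 [h1 [h1_0 dw1 ->]]] [w2 [h2 [h2_0 dw2 ->]]].
exists (w1 * w2), (h1 + h2); split; [exact: SD | | ring].
by rewrite fps_DM dw1 dw2; ring.
Qed.

Lemma log_ge_gt_trans (f g k : fps) : log_ge f g -> log_gt g k -> log_gt f k.
Proof.
move=> [w1 [h1 [h1_0 dw1 ->]]] [w2 [h2 [h2_0 dw2 ->]]].
exists (w1 * w2), (h2 + h1); split; [exact: fps_gt0D | | ring].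
by rewrite fps_DM dw1 dw2; ring.
Qed.

(** For [w = 1 - X z], the series [- w' / w] is [(X z)'] divided by [1 - X z]. *)
Lemma log_mul1B (S : fps -> Prop) (f z : fps) :
  S (fps_D (fps_X * z) * fps_star z) -> log_ge_by S f (f * (1 - fps_X * z)).
Proof.
move=> Sz; exists (1 - fps_X * z), (fps_D (fps_X * z) * fps_star z); split=> //.
rewrite -mulrA [fps_star z * _]mulrC fps_starK fps_DD fps_D1 fps_DN; ring.
Qed.

Lemma log_ge_mul1B (f z : fps) :
  fps_ge0 z -> log_ge f (f * (1 - fps_X * z)).
Proof.
move=> z0; apply: log_mul1B.
by apply: fps_ge0M; [exact: fps_ge0_DX | exact: fps_ge0_star].
Qed.

Lemma log_gt_mul1B (f z : fps) :
  fps_gt0 z -> log_gt f (f * (1 - fps_X * z)).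
Proof.
move=> z0; apply: log_mul1B.
by apply: fps_gt0M; [exact: fps_gt0_DX | exact: fps_gt0_star z0.1].
Qed.

(** * The characteristic series of a starlike tree *)

(** The generating function of the closed walks at an end vertex of the path on
    [m] vertices ([0] for [m = 0]); it is [path_Phi m.-1 / path_Phi m] for [0 < m]. *)
Fixpoint path_G (m : nat) : fps :=
  if m is k.+1 then fps_star (fps_X * path_G k) else 0.

Arguments path_G : simpl never.

(** Eliminating a path from one end, the pivots of [I - xA] are the [1 - X^2 G_i]; [center_Phi] is
    the pivot left at the centre of a starlike tree. *)
Definition path_Phi (m : nat) : fps :=
  \prod_(i < m) (1 - fps_X * (fps_X * path_G i)).

Definition paths_Phi (s : seq nat) : fps := \prod_(x <- s) path_Phi x.
Definition center_Phi (s : seq nat) : fps :=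
  1 - fps_X * (fps_X * \sum_(x <- s) path_G x).
Definition star_Phi (s : seq nat) : fps := paths_Phi s * center_Phi s.

Lemma path_GK (m : nat) : (1 - fps_X * (fps_X * path_G m)) * path_G m.+1 = 1.
Proof. exact: fps_starK. Qed.

(** The recurrence for [path_G] in the form that serves [ring] as a rewriting rule. *)
Lemma path_GX (m : nat) :
  fps_X * (fps_X * (path_G m * path_G m.+1)) = path_G m.+1 - 1.
Proof. by rewrite -[in RHS](path_GK m); ring. Qed.

Lemma path_G_ge0 (m : nat) : fps_ge0 (path_G m).
Proof.
elim: m => [|m IH]; first exact: fps_ge0_0.
by apply: fps_ge0_star; apply: fps_ge0M => //; exact: fps_ge0_X.
Qed.

Lemma path_G_gt0 (m : nat) : fps_gt0 (path_G m.+1).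
Proof.
apply: fps_gt0_star; apply: fps_ge0M; [exact: fps_ge0_X | exact: path_G_ge0].
Qed.

(** Induction: each difference is [X^2 * path_G m.+2 * path_G m.+1] times the previous one. *)
Lemma path_GBS (m : nat) : fps_gt0 (path_G m.+1 - path_G m).
Proof.
elim: m => [|m IH].
  by rewrite subr0; exact: path_G_gt0.
have -> : path_G m.+2 - path_G m.+1 =
    fps_X * (fps_X * (path_G m.+2 * path_G m.+1)) * (path_G m.+1 - path_G m).
  transitivity (path_G m.+2 * ((1 - fps_X * (fps_X * path_G m)) * path_G m.+1)
      - (1 - fps_X * (fps_X * path_G m.+1)) * path_G m.+2 * path_G m.+1); last by ring.
  by rewrite !path_GK mulr1 mul1r.
do !apply: fps_gt0M => //; solve [exact: fps_gt0_X | exact: path_G_gt0].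
Qed.

Lemma path_GB_ge0 (m k : nat) : (m <= k)%N -> fps_ge0 (path_G k - path_G m).
Proof.
move=> /subnKC <-; elim: (k - m)%N => [|j IH].
  by rewrite addn0 subrr; exact: fps_ge0_0.
rewrite addnS -(subrK (path_G (m + j)) (path_G _.+1)) -addrA.
by apply: fps_ge0D => //; exact: (path_GBS _).1.
Qed.

Lemma path_GB_gt0 (m k : nat) : (m < k)%N -> fps_gt0 (path_G k - path_G m).
Proof.
case: k => // k le_mk; rewrite -(subrK (path_G k) (path_G _.+1)) -addrA.
by apply: fps_gt0D; [exact: path_GBS | exact: path_GB_ge0].
Qed.

Lemma path_PhiS (m : nat) :
  path_Phi m.+1 = path_Phi m * (1 - fps_X * (fps_X * path_G m)).
Proof. exact: big_ord_recr. Qed.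

Lemma paths_Phi_cons (x : nat) (s : seq nat) :
  paths_Phi (x :: s) = path_Phi x * paths_Phi s.
Proof. exact: big_cons. Qed.

Lemma paths_Phi_cat (s t : seq nat) :
  paths_Phi (s ++ t) = paths_Phi s * paths_Phi t.
Proof. exact: big_cat. Qed.

Lemma paths_Phi_perm (s t : seq nat) :
  perm_eq s t -> paths_Phi s = paths_Phi t.
Proof. exact: perm_big. Qed.

Lemma star_Phi_perm (s t : seq nat) : perm_eq s t -> star_Phi s = star_Phi t.
Proof.
move=> st; rewrite /star_Phi (paths_Phi_perm st); congr (_ * _).
by rewrite /center_Phi (perm_big _ st).
Qed.

(** * Balancing steps on lists of lengths, for an abstract preorder *)

Section Unbalancing.
Variables (T : Type) (le : T -> T -> Prop) (F : seq nat -> T).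
Hypothesis le_refl : forall x, le x x.
Hypothesis le_trans : forall y x z, le x y -> le y z -> le x z.
Hypothesis F_perm : forall s t, perm_eq s t -> F s = F t.
Hypothesis F_step : forall e f r, (e <= f)%N ->
  le (F (e :: f.+1 :: r)) (F (e.+1 :: f :: r)).

(** Raise [e] to the smaller of [c] and [d] one unit at a time; the other entry stays large enough
    for every [F_step]. *)
Lemma unbalance2 (e c d : nat) (r : seq nat) : (e <= c)%N -> (e <= d)%N ->
  le (F (e :: (c + d - e)%N :: r)) (F (c :: d :: r)).
Proof.
wlog le_cd : c d / (c <= d)%N => [H le_ec le_ed|le_ec le_ed].
  case: (leqP c d) => [|/ltnW] le_cd; first exact: H.
  rewrite addnC (@F_perm (c :: d :: r) (d :: c :: r)); first exact: H.
  by rewrite (perm_catCA [:: c] [:: d] r).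
have -> : (c + d - e = (c - e) + d)%N by lia.
rewrite -[X in le _ (F (X :: _))](subnKC le_ec).
have : (e + (c - e) <= d)%N by rewrite subnKC.
elim: (c - e)%N d {le_cd le_ed} => [|j IH] d le_jd; first by rewrite addn0.
rewrite addnS addSnnS; apply: le_trans (IH d.+1 _) _; first by lia.
by apply: F_step; lia.
Qed.

(** By induction the tail becomes copies of [e] and one large entry [D]; then [unbalance2] trades
    [x] against [D]. *)
Lemma unbalance (e : nat) (s r : seq nat) :
  all (fun x => e <= x)%N s -> (0 < size s)%N ->
  le (F (nseq (size s).-1 e ++ (sumn s - (size s).-1 * e)%N :: r)) (F (s ++ r)).
Proof.
elim: s r => // x [|y s] IH r /andP[le_ex le_es] _.
  by rewrite /= addn0 subn0.
have /= := IH (x :: r) le_es isT; set D := (_ - _)%N => IHr.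
have le_eD : (e <= D)%N.
  rewrite /D; move: le_es => /=/andP[le_ey /allP le_es].
  have : (size s * e <= sumn s)%N.
    elim: s le_es {IH IHr D} => //= z s IH le_es; rewrite mulSn leq_add ?le_es ?mem_head //.
    by apply: IH => u us; rewrite le_es // inE us orbT.
  by lia.
have permr : perm_eq ((y :: s) ++ x :: r) ((x :: y :: s) ++ r).
  by rewrite -[x :: r]cat1s perm_catCA.
rewrite -(F_perm permr); apply: le_trans IHr.
have -> : (sumn [:: x, y & s] - (size [:: x, y & s]).-1 * e = D + x - e)%N.
  by rewrite /D /=; lia.
rewrite (@F_perm _ (e :: (D + x - e)%N :: nseq (size s) e ++ r)); last first.
  by rewrite /= perm_cons -cat1s perm_catCA.
rewrite [X in le _ X](@F_perm _ (D :: x :: nseq (size s) e ++ r)); last first.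
  by rewrite -[D :: x :: r]cat1s -[x :: r]cat1s perm_catCA /= perm_cons -(cat1s x) perm_catCA.
exact: unbalance2.
Qed.
End Unbalancing.

(** The quotient is [(1 - X^2 G_f) / (1 - X^2 G_e) = 1 - X^2 G_(e+1) (G_f - G_e)]. Without a centre
    it is the unbalanced list that has more walks, opposite to [log_ge_star_step]. *)
Lemma log_ge_paths_step (e f : nat) (r : seq nat) : (e <= f)%N ->
  log_ge (paths_Phi (e.+1 :: f :: r)) (paths_Phi (e :: f.+1 :: r)).
Proof.
move=> le_ef; have -> : paths_Phi (e :: f.+1 :: r) = paths_Phi (e.+1 :: f :: r) *
    (1 - fps_X * (fps_X * (path_G e.+1 * (path_G f - path_G e)))).
  by rewrite !paths_Phi_cons !path_PhiS; ring: (path_GX e).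
apply: log_ge_mul1B; apply: fps_ge0M; first exact: fps_ge0_X.
by apply: fps_ge0M; [exact: path_G_ge0 | exact: path_GB_ge0].
Qed.

Lemma log_ge_paths (e : nat) (s : seq nat) :
  all (fun x => e <= x)%N s -> (0 < size s)%N ->
  log_ge (paths_Phi s)
    (paths_Phi (nseq (size s).-1 e ++ [:: (sumn s - (size s).-1 * e)%N])).
Proof.
move=> le_es s0; rewrite -[X in log_ge (paths_Phi X)]cats0.
(* The order is reversed because for disjoint paths balancing removes walks. *)
apply: (@unbalance _ (fun x y => log_ge y x) paths_Phi) => //.
- exact: log_ge_refl.
- by move=> y x z xy yz; exact: log_ge_trans fps_ge0D yz xy.
- exact: paths_Phi_perm.
- exact: log_ge_paths_step.
Qed.

(** With [lam := G_(d+1) / G_(c+1)] and [Y := X^2], replacing the branches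
    [c :: s] by [nseq (size s) c.+1 ++ [:: d]] changes [center_Phi] into
    [lam^-1 * (center_Phi - Y * jump_gain)]. The choice of [lam] eliminates all
    the negative terms, which is what makes the comparison go through. *)
Definition jump_gain (c d : nat) (s r : seq nat) : fps :=
  \sum_(x <- s) (path_G d.+1 - path_G x)
  + fps_X * (fps_X * (path_G d.+1 * (path_G d - path_G c))) * \sum_(x <- r) path_G x.

(** The factor in front is [lam], with [1 - X^2 G_c] as the inverse of [G_(c+1)]. Pulling out the
    old [center_Phi] by means of its inverse [fps_star _] leaves a factor of the shape required by
    [log_mul1B]. *)
Lemma center_Phi_jump (c d : nat) (s r : seq nat) :
  path_G d.+1 * (1 - fps_X * (fps_X * path_G c))
    * center_Phi (nseq (size s) c.+1 ++ d :: r) =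
  center_Phi (c :: s ++ r) *
    (1 - fps_X * (fps_X * (fps_star (fps_X * \sum_(x <- c :: s ++ r) path_G x)
                           * jump_gain c d s r))).
Proof.
rewrite /jump_gain /center_Phi; set T := \sum_(x <- c :: _) _.
have TK := fps_starK (fps_X * T); set U := fps_star _ in TK *.
transitivity (1 - fps_X * (fps_X * T) - fps_X * (fps_X * jump_gain c d s r)); last first.
  have TX : fps_X * (fps_X * (T * U)) = U - 1 by rewrite -[in RHS]TK; ring.
  by rewrite -/(jump_gain c d s r); ring: TX.
rewrite /jump_gain /T big_cat !big_cons big_cat /= big_nseq iter_addr_0.
rewrite big_split /= sumrN big_const_seq count_predT iter_addr_0.
set A := \sum_(x <- s) _; set B := \sum_(x <- r) _.
rewrite -mulr_natl -[path_G d.+1 *+ _]mulr_natl.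
(* Since [lam * G_(c+1) = G_(d+1)] and [lam * (1 - X^2 G_d) = 1 - X^2 G_c], both sides equal [1 -
   X^2 (G_c + size s * G_(d+1) + lam * B)]. *)
by ring: (path_GX c) (path_GX d).
Qed.

(** Trading one pair of paths [c.+1, d] for [c, d.+1] costs exactly the factor [lam], which
    [center_Phi_jump] absorbs. *)
Lemma star_Phi_jump (c d : nat) (s r : seq nat) : (0 < size s)%N ->
  star_Phi (nseq (size s) c.+1 ++ d :: r) =
  path_Phi c * paths_Phi r * paths_Phi (nseq (size s).-1 c.+1 ++ [:: d.+1])
  * (path_G d.+1 * (1 - fps_X * (fps_X * path_G c))
     * center_Phi (nseq (size s) c.+1 ++ d :: r)).
Proof.
case: s => // x s _; rewrite /star_Phi.
set K := center_Phi _; rewrite /= paths_Phi_cons !paths_Phi_cat !paths_Phi_cons.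
rewrite !path_PhiS [paths_Phi [::]]big_nil.
by ring: (path_GX d).
Qed.

Lemma leq_size_sumn (e : nat) (s : seq nat) :
  all (fun x => e <= x)%N s -> (size s * e <= sumn s)%N.
Proof. by elim: s => //= x s IH /andP[le_ex /IH]; rewrite mulSn; apply: leq_add. Qed.

Lemma leq_mem_sumn (e x : nat) (s : seq nat) :
  all (fun x => e <= x)%N s -> x \in s -> (x + (size s).-1 * e <= sumn s)%N.
Proof.
move=> le_es xs; have := perm_to_rem xs => ps.
rewrite (perm_sumn ps) (perm_size ps) /= leq_add2l leq_size_sumn //.
by move: le_es; rewrite (perm_all _ ps) /= => /andP[].
Qed.

Lemma fps_gt0_sum (s : seq nat) (F : nat -> fps) (x : nat) : x \in s ->
  {in s, forall y, fps_ge0 (F y)} -> fps_gt0 (F x) -> fps_gt0 (\sum_(y <- s) F y).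
Proof.
move=> xs F0 Fx; rewrite (big_rem _ xs) /=; apply: fps_gt0D => //.
rewrite big_seq; apply: fps_ge0_sum => y /mem_rem; exact: F0.
Qed.

Lemma sum_path_G_ge0 (s : seq nat) : fps_ge0 (\sum_(x <- s) path_G x).
Proof. by apply: fps_ge0_sum => x _; exact: path_G_ge0. Qed.

Lemma sum_path_G_gt0 (s : seq nat) :
  has (fun x => 0 < x)%N s -> fps_gt0 (\sum_(x <- s) path_G x).
Proof.
move=> /hasP[[|x] // xs _]; apply: (fps_gt0_sum xs); last exact: path_G_gt0.
by move=> y _; exact: path_G_ge0.
Qed.

(** Separates the paths from the centre. The sum condition reads
    [sumn s = (size s).-1 * c.+1 + d.+1], so [log_ge_paths] compares [s] with the paths left by
    [star_Phi_jump]. *)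
Lemma star_Phi_jump_factor (c d : nat) (s r : seq nat) :
  (0 < size s)%N -> all (fun x => c < x)%N s ->
  (c + sumn s = size s * c.+1 + d)%N ->
  exists f g, [/\ log_ge f g,
    star_Phi (c :: s ++ r) = center_Phi (c :: s ++ r) * f &
    star_Phi (nseq (size s) c.+1 ++ d :: r) =
      center_Phi (c :: s ++ r) *
        (1 - fps_X * (fps_X * (fps_star (fps_X * \sum_(x <- c :: s ++ r) path_G x)
                           * jump_gain c d s r))) * g].
Proof.
move=> s0 lt_cs sum_s.
exists (path_Phi c * paths_Phi r * paths_Phi s),
  (path_Phi c * paths_Phi r * paths_Phi (nseq (size s).-1 c.+1 ++ [:: d.+1])).
split.
- apply: (log_geM fps_ge0D); first exact: log_ge_refl.
  have := log_ge_paths lt_cs s0; congr (log_ge _ (paths_Phi (_ ++ [:: _]))).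
  by move: s0 sum_s; case: (size s) => // k _ /=; lia.
- by rewrite /star_Phi paths_Phi_cons paths_Phi_cat; ring.
- by rewrite star_Phi_jump // center_Phi_jump [RHS]mulrC.
Qed.

(** As the other entries of [s] are at least [c.+1], the sum condition bounds each entry by
    [d.+1]. *)
Lemma jump_gain_ge0 (c d : nat) (s r : seq nat) : (c <= d)%N ->
  all (fun x => c < x)%N s -> (c + sumn s = size s * c.+1 + d)%N ->
  {in s, forall x, fps_ge0 (path_G d.+1 - path_G x)} /\
  fps_ge0 (fps_X * (fps_X * (path_G d.+1 * (path_G d - path_G c)))
           * \sum_(x <- r) path_G x).
Proof.
move=> le_cd lt_cs sum_s; split=> [x xs|].
  apply: path_GB_ge0; have := leq_mem_sumn lt_cs xs.
  have : (0 < size s)%N by case: (s) xs.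
  by move: sum_s; case: (size s) => // k /=; lia.
have X0 := fps_ge0_X; have GB := path_GB_ge0 le_cd.
have G0 := path_G_ge0; have S0 := sum_path_G_ge0.
by do !apply: fps_ge0M.
Qed.

Lemma log_ge_jump (c d : nat) (s r : seq nat) :
  (c <= d)%N -> (0 < size s)%N -> all (fun x => c < x)%N s ->
  (c + sumn s = size s * c.+1 + d)%N ->
  log_ge (star_Phi (c :: s ++ r)) (star_Phi (nseq (size s) c.+1 ++ d :: r)).
Proof.
move=> le_cd s0 lt_cs sum_s.
have [f [g [fg -> ->]]] := star_Phi_jump_factor r s0 lt_cs sum_s.
apply: (log_geM fps_ge0D) => //; apply: log_ge_mul1B.
have [gs gr] := jump_gain_ge0 r le_cd lt_cs sum_s.
apply: fps_ge0M; first exact: fps_ge0_X.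
apply: fps_ge0M.
  by apply/fps_ge0_star/fps_ge0M; [exact: fps_ge0_X | exact: sum_path_G_ge0].
by apply: fps_ge0D => //; rewrite big_seq; apply: fps_ge0_sum.
Qed.

(** Either summand of [jump_gain] can give strictness. The last hypothesis excludes the case where
    both trees are the same path. *)
Lemma log_gt_jump (c d : nat) (s r : seq nat) :
  (c < d)%N -> (0 < size s)%N -> all (fun x => c < x)%N s ->
  (c + sumn s = size s * c.+1 + d)%N ->
  (1 < size s)%N || has (fun x => 0 < x)%N r ->
  log_gt (star_Phi (c :: s ++ r)) (star_Phi (nseq (size s) c.+1 ++ d :: r)).
Proof.
move=> lt_cd s0 lt_cs sum_s sr.
have [f [g [fg -> ->]]] := star_Phi_jump_factor r s0 lt_cs sum_s.
apply: (log_geM fps_gt0D) => //; apply: log_gt_mul1B.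
have [gs gr] := jump_gain_ge0 r (ltnW lt_cd) lt_cs sum_s.
apply: fps_gt0M; first exact: fps_gt0_X.
apply: fps_gt0M.
  by apply/fps_gt0_star/fps_ge0M; [exact: fps_ge0_X | exact: sum_path_G_ge0].
case/orP: sr => [s1|r0]; last first.
  rewrite /jump_gain addrC; apply: fps_gt0D; last first.
    by rewrite big_seq; apply: fps_ge0_sum.
  have X0 := fps_gt0_X; have GB := path_GB_gt0 lt_cd.
  have G0 := path_G_gt0; have S0 := sum_path_G_gt0 r0.
  by do !apply: fps_gt0M.
apply: fps_gt0D => //.
(* Otherwise [size s * d.+1 <= (size s).-1 * c.+1 + d.+1], impossible for [c < d] and
   [1 < size s]. *)
have /hasP[x xs lt_xd] : has (fun x => x < d.+1)%N s.
  apply: contraT; rewrite -all_predC => /allP le_ds.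
  have : (size s * d.+1 <= sumn s)%N.
    by apply: leq_size_sumn; apply/allP => x /le_ds /=; rewrite -leqNgt.
  by nia.
by apply: (fps_gt0_sum xs) => //; exact: path_GB_gt0.
Qed.

Lemma log_ge_star_step (e f : nat) (r : seq nat) : (e <= f)%N ->
  log_ge (star_Phi (e :: f.+1 :: r)) (star_Phi (e.+1 :: f :: r)).
Proof. by move=> le_ef; apply: (@log_ge_jump e f [:: f.+1]) => //=; lia. Qed.

Lemma log_ge_unbalanced (e : nat) (s r : seq nat) :
  all (fun x => e <= x)%N s -> (0 < size s)%N ->
  log_ge (star_Phi (nseq (size s).-1 e ++ (sumn s - (size s).-1 * e)%N :: r))
         (star_Phi (s ++ r)).
Proof.
apply: unbalance.
- exact: log_ge_refl.
- by move=> y x z; exact: (log_ge_trans fps_ge0D).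
- exact: star_Phi_perm.
- exact: log_ge_star_step.
Qed.

(** Balancing steps [(c, x) -> (c+1, x-1)] first remove all but one occurrence of
    [c]; one jump then leads to the most unbalanced sequence above [c], and
    balancing steps lead from there to [t]. *)
Lemma log_gt_raise_min (c : nat) (s t r : seq nat) :
  c \in s -> all (fun x => c <= x)%N s -> all (fun x => c < x)%N t ->
  size s = size t -> sumn s = sumn t ->
  (2 < size s)%N || has (fun x => 0 < x)%N r ->
  log_gt (star_Phi (s ++ r)) (star_Phi (t ++ r)).
Proof.
move=> cs le_cs lt_ct eq_sz eq_sum s_r.
have [k] : exists k, count_mem c s = k.+1.
  by move: cs; rewrite -has_pred1 has_count; case: (count _ _) => // k _; exists k.
(* This lower bound on the common sum yields both the part [x] to be lowered and the inequality
   [c < d] for the final jump. *)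
have := leq_size_sumn lt_ct.
elim: k s cs le_cs eq_sz eq_sum s_r => [|k IH] s cs le_cs eq_sz eq_sum s_r le_sum ck.
  have ps := perm_to_rem cs; set u := rem c s in ps.
  have lt_cu : all (fun x => c < x)%N u.
    move: ck le_cs; rewrite (permP ps) (perm_all _ ps) /= eqxx => -[cu] /andP[_ /allP le_cu].
    apply/allP => x xu; rewrite ltn_neqAle le_cu // andbT.
    apply: contraTneq xu => <-; rewrite -has_pred1 has_count.
    by move: cu; rewrite add0n => ->.
  have sz_u : size s = (size u).+1 by rewrite (perm_size ps).
  have sum_u : sumn s = (c + sumn u)%N by rewrite (perm_sumn ps).
  have u0 : (0 < size u)%N.
    case: u ps lt_cu sz_u sum_u => //= _ _ sz_u sum_u.
    by move: le_sum; rewrite -eq_sum -eq_sz sum_u sz_u; lia.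
  rewrite (@star_Phi_perm (s ++ r) (c :: u ++ r)); last by rewrite -cat_cons perm_cat2r.
  have t0 : (0 < size t)%N by rewrite -eq_sz sz_u.
  apply: (log_ge_trans fps_gt0D) (log_ge_unbalanced r lt_ct t0).
  move: le_sum s_r; rewrite -eq_sz -eq_sum sz_u sum_u mulSn /= => le_sum s_r.
  by apply: log_gt_jump => //; move: le_sum; set m := (_ * _)%N; lia.
(* Otherwise [sumn s] is at most [c + (size s).-1 * c.+1], below the bound [le_sum]. *)
have /hasP[x xs lt_cx] : has (fun x => c.+1 < x)%N s.
  apply: contraT; rewrite -all_predC => /allP le_sc.
  have ps := perm_to_rem cs.
  have : (sumn (rem c s) <= size (rem c s) * c.+1)%N.
    have : all (fun x => x <= c.+1)%N (rem c s).
      by apply/allP => x /mem_rem /le_sc /=; rewrite -leqNgt.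
    by elim: (rem c s) => //= x u IHu /andP[le_xc /IHu]; rewrite mulSn; apply: leq_add.
  by move: le_sum; rewrite -eq_sum -eq_sz (perm_sumn ps) (perm_size ps) /=; lia.
have [u ps] : exists u, perm_eq s (c :: x :: u).
  exists (rem x (rem c s)); rewrite (permPl (perm_to_rem cs)) perm_cons.
  apply: perm_to_rem; move: xs; rewrite (perm_mem (perm_to_rem cs)) inE.
  by case/predU1P => // xc; rewrite xc in lt_cx; lia.
have ps' : perm_eq (s ++ r) (c :: x.-1.+1 :: u ++ r).
  by rewrite prednK ?(leq_trans _ lt_cx) // -!cat_cons perm_cat2r.
rewrite (star_Phi_perm ps').
(* As [x.-1] is still above [c], this step removes exactly one occurrence of [c]. *)
apply: (@log_ge_gt_trans (star_Phi (c :: x.-1.+1 :: u ++ r)) (star_Phi (c.+1 :: x.-1 :: u ++ r))).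
  by apply: log_ge_star_step; lia.
move: eq_sz eq_sum s_r ck le_cs; rewrite (perm_size ps) (perm_sumn ps) (permP ps) (perm_all _ ps) /=.
move=> eq_sz eq_sum s_r ck /and3P[_ _ le_cu].
rewrite -!cat_cons; apply: IH => //=.
- by move: ck; rewrite eqxx (gtn_eqF (ltnW lt_cx)) -has_pred1 has_count /=; lia.
- by rewrite leqnSn le_cu andbT /=; lia.
- by rewrite -eq_sum; lia.
- by move: ck; rewrite eqxx !gtn_eqF //; lia.
Qed.

(** * Closed walks and determinants *)

Section Walks.
Variables (T : finType) (e : rel T).

Definition is_walk (k : nat) (w : {ffun 'I_k.+1 -> T}) : bool :=
  [forall i : 'I_k, e (w (widen_ord (leqnSn k) i)) (w (lift ord0 i))].

Definition walks (k : nat) (u v : T) : nat :=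
  (\sum_(w : {ffun 'I_k.+1 -> T}) [&& w ord0 == u, w ord_max == v & is_walk w])%N.

Lemma closed_walksE (k : nat) : closed_walks e k = (\sum_u walks k u u)%N.
Proof.
rewrite /closed_walks -sum1_card exchange_big big_mkcond /=.
apply: eq_bigr => w _; rewrite inE -/(is_walk w).
rewrite (bigD1 (w ord0)) //= eqxx eq_sym big1 ?addn0; last first.
  by move=> u /negPf uw; rewrite eq_sym uw.
by case: (_ && _).
Qed.

Lemma closed_walks0 : closed_walks e 0 = #|T|.
Proof.
rewrite /closed_walks -[RHS]expn1 -[X in (_ ^ X)%N]card_ord -card_ffun.
apply: eq_card => w; rewrite !inE (ord1 ord_max) eqxx.
by apply/forallP => -[].
Qed.

Lemma walks0 (u v : T) : walks 0 u v = (u == v).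
Proof.
rewrite /walks (bigD1 [ffun=> u]) //= big1 ?addn0 => [|w].
  rewrite !ffunE eqxx /=; have -> : @is_walk 0 [ffun=> u].
    by apply/forallP => -[].
  by rewrite andbT.
apply: contraNeq; rewrite eqb0 negbK => /and3P[/eqP wu _ _].
by apply/eqP/ffunP => i; rewrite ffunE (ord1 i).
Qed.

Definition walk_cons (k : nat) (p : T * {ffun 'I_k.+1 -> T}) :
    {ffun 'I_k.+2 -> T} :=
  [ffun i => if unlift ord0 i is Some j then p.2 j else p.1].

Lemma walk_cons0 (k : nat) (p : T * {ffun 'I_k.+1 -> T}) :
  walk_cons p ord0 = p.1.
Proof. by rewrite ffunE unlift_none. Qed.

Lemma walk_cons_lift (k : nat) (p : T * {ffun 'I_k.+1 -> T}) (i : 'I_k.+1) :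
  walk_cons p (lift ord0 i) = p.2 i.
Proof. by rewrite ffunE liftK. Qed.

Lemma walk_cons_bij (k : nat) : bijective (@walk_cons k).
Proof.
exists (fun w : {ffun 'I_k.+2 -> T} => (w ord0, [ffun i => w (lift ord0 i)])).
  move=> [x w].
  by rewrite walk_cons0; congr (_, _); apply/ffunP => i; rewrite ffunE walk_cons_lift.
move=> w; apply/ffunP => i; case: (unliftP ord0 i) => [j ->|->].
  by rewrite walk_cons_lift ffunE.
by rewrite walk_cons0.
Qed.

Lemma is_walk_cons (k : nat) (x : T) (w : {ffun 'I_k.+1 -> T}) :
  is_walk (walk_cons (x, w)) = e x (w ord0) && is_walk w.
Proof.
have w0 : walk_cons (x, w) (widen_ord (leqnSn k.+1) ord0) = x.
  by rewrite -[RHS](walk_cons0 (x, w)); congr (walk_cons _ _); exact: val_inj.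
have wl (j : 'I_k) : walk_cons (x, w) (widen_ord (leqnSn k.+1) (lift ord0 j)) =
    w (widen_ord (leqnSn k) j).
  rewrite -[RHS](walk_cons_lift (x, w)).
  by congr (walk_cons _ _); exact: val_inj.
apply/forallP/andP => [H|[e0 /forallP H] i].
  split; first by have := H ord0; rewrite w0 walk_cons_lift.
  by apply/forallP => j; have := H (lift ord0 j); rewrite wl walk_cons_lift.
by case: (unliftP ord0 i) => [j|] ->; rewrite ?w0 ?wl walk_cons_lift.
Qed.

Lemma walksS (k : nat) (u v : T) :
  walks k.+1 u v = (\sum_z e u z * walks k z v)%N.
Proof.
rewrite {1}/walks (reindex _ (onW_bij _ (walk_cons_bij k))) /=.
rewrite -(pair_bigA _ (fun x w => [&& walk_cons (x, w) ord0 == u,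
  walk_cons (x, w) ord_max == v & is_walk (walk_cons (x, w))] : nat)) /=.
rewrite (bigD1 u) //= [X in (_ + X)%N]big1 ?addn0; last first.
  by move=> x /negPf xu; rewrite big1 // => w _; rewrite walk_cons0 xu.
under [RHS]eq_bigr do rewrite /walks big_distrr /=.
rewrite exchange_big /=; apply: eq_bigr => w _.
rewrite (bigD1 (w ord0)) //= [X in (_ + X)%N]big1 ?addn0; last first.
  by move=> z /negPf zw; rewrite eq_sym zw muln0.
rewrite walk_cons0 !eqxx is_walk_cons /=.
have -> : ord_max = lift ord0 (ord_max : 'I_k.+1) by exact: val_inj.
by rewrite walk_cons_lift /=; case: (e _ _); rewrite ?mul1n // mul0n andbF.
Qed.
End Walks.

(** Jacobi's formula: the product rule differentiates one row at a time, and each resulting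
    determinant is expanded along that row. *)
Lemma fps_D_det (n : nat) (A : 'M[fps]_n) :
  fps_D (\det A) = \sum_i \sum_j fps_D (A i j) * cofactor A i j.
Proof.
pose A' i := \matrix_(k, l) (if k == i then fps_D (A i l) else A k l).
transitivity (\sum_i \det (A' i)); last first.
  apply: eq_bigr => i _; rewrite (expand_det_row _ i); apply: eq_bigr => j _.
  rewrite mxE eqxx; congr (_ * ((-1) ^+ _ * \det _)).
  by apply/matrixP => k l; rewrite !mxE eq_sym (negPf (neq_lift _ _)).
rewrite exchange_big fps_D_sum; apply: eq_bigr => s _ /=.
have sgnD (b : bool) (P : fps) : fps_D ((-1) ^+ b * P) = (-1) ^+ b * fps_D P.
  by case: b; rewrite ?mul1r // !mulN1r fps_DN.
rewrite sgnD fps_D_prod mulr_sumr; apply: eq_bigr => i _; congr (_ * _).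
rewrite [RHS](bigD1 i) //= mxE eqxx; congr (_ * _).
by apply: eq_bigr => j /negPf ji; rewrite mxE ji.
Qed.

Section CharSeries.
Variables (n : nat) (e : rel 'I_n.+1).

Definition adj_mx : 'M[fps]_n.+1 := \matrix_(i, j) (e i j)%:R.
Definition char_series : fps := \det (1%:M - fps_X *: adj_mx).
Definition walk_mx : 'M[fps]_n.+1 :=
  \matrix_(i, j) ((fun k => (walks e k i j)%:R) : fps).
Definition walk_series : fps := fun k => (closed_walks e k.+1)%:R.

Lemma fps_nat (m k : nat) : (m%:R : fps) k = if k is 0%N then m%:R else 0.
Proof.
elim: m => [|m IH]; first by rewrite mulr0n fps0; case: k.
by rewrite -!natr1 fpsD IH fps1; case: k {IH} => //; rewrite addr0.
Qed.

Lemma fps_natM (m : nat) (f : fps) (k : nat) : (m%:R * f) k = m%:R * f k.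
Proof.
rewrite fpsM big_ord_recl fps_nat subn0 big1 ?addr0 // => i _.
by rewrite fps_nat mul0r.
Qed.

Lemma adj_walk_mxE (i j : 'I_n.+1) (k : nat) :
  (adj_mx *m walk_mx) i j k = (walks e k.+1 i j)%:R.
Proof.
rewrite mxE fps_sum walksS natr_sum; apply: eq_bigr => z _.
by rewrite !mxE fps_natM natrM.
Qed.

(** [walk_mx] is the Neumann series for the inverse of [I - xA]; coefficientwise this is
    [walksS]. *)
Lemma resolventK : (1%:M - fps_X *: adj_mx) *m walk_mx = 1%:M.
Proof.
apply/eqP; rewrite mulmxBl mul1mx -scalemxAl subr_eq; apply/eqP.
apply/matrixP => i j; rewrite [RHS]mxE [X in _ = _ + X]mxE.
apply: fpsP => -[|k]; rewrite fpsD fps_XM; first by rewrite !mxE walks0 fps_nat addr0.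
by rewrite adj_walk_mxE !mxE fps_nat add0r.
Qed.

Lemma char_series_unit : char_series * \det walk_mx = 1.
Proof. by rewrite -det_mulmx resolventK det1. Qed.

(** The adjugate of [I - xA] is [char_series *: walk_mx], so Jacobi's formula gives minus
    [char_series] times the trace of [adj_mx *m walk_mx], which counts closed walks. *)
Lemma fps_D_char_series :
  fps_D char_series = - (char_series * walk_series).
Proof.
have BK := resolventK; set B := 1%:M - _ in BK.
have adjB : \adj B = char_series *: walk_mx.
  by rewrite -[LHS]mulmx1 -BK mulmxA mul_adj_mx mul_scalar_mx.
rewrite /char_series -/B fps_D_det.
have -> : walk_series = \sum_i \sum_j adj_mx i j * walk_mx j i.
  apply: fpsP => k; rewrite fps_sum /walk_series closed_walksE natr_sum.
  by apply: eq_bigr => i _; rewrite -adj_walk_mxE [in LHS]mxE.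
rewrite mulr_sumr -sumrN; apply: eq_bigr => i _.
rewrite mulr_sumr -sumrN; apply: eq_bigr => j _.
have -> : cofactor B i j = \adj B j i by rewrite mxE.
rewrite adjB [(_ *: walk_mx) _ _]mxE -/B -/char_series.
have -> : fps_D (B i j) = - adj_mx i j.
  rewrite !mxE fps_DD fps_DN fps_DM fps_DX mul1r.
  have Dn (b : bool) : fps_D b%:R = 0 by case: b; rewrite ?fps_D1 ?fps_D0.
  by rewrite !Dn mulr0 addr0 add0r.
ring.
Qed.
End CharSeries.

(** Logarithmic differentiation shows that the two walk series differ by [h]; [char_series e2]
    cancels as it is invertible. Length 0 is outside these series and is settled by [n = m]. *)
Lemma walk_lt_char_series (n m : nat) (e1 : rel 'I_n.+1) (e2 : rel 'I_m.+1) :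
  n = m -> log_gt (char_series e1) (char_series e2) -> walk_lt e1 e2.
Proof.
move=> eq_nm [w [h [h_gt0 Dw e2E]]].
have D1 := fps_D_char_series e1; have D2 := fps_D_char_series e2.
have eq_h : walk_series e2 = walk_series e1 + h.
  have : char_series e2 * (walk_series e2 - walk_series e1 - h) = 0.
    have : fps_D (char_series e2) = - (char_series e2 * (walk_series e1 + h)).
      by rewrite e2E fps_DM D1 Dw; ring.
    by rewrite D2 => /oppr_inj E; rewrite -addrA -opprD mulrBr E subrr.
  move=> /(congr1 (fun f => \det (walk_mx e2) * f)).
  rewrite mulr0 mulrA [\det _ * _]mulrC char_series_unit mul1r -addrA -opprD.
  by move=> /eqP; rewrite subr_eq0 => /eqP.
have hk k : (closed_walks e2 k.+1)%:R = (closed_walks e1 k.+1)%:R + h k :> int.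
  by have := congr1 (fun f : fps => f k) eq_h.
case: h_gt0 => h_ge0 [k h_k]; split=> [[|j]|].
- by rewrite !closed_walks0 !card_ord eq_nm.
- by rewrite -(ler_nat int) hk lerDl.
- by exists k.+1; rewrite -(ltr_nat int) hk ltrDl.
Qed.

(** * Elimination on a rooted tree, with pivots [d] and inverse pivots [g] *)

Section Forest.
Variables (n : nat) (par : 'I_n.+1 -> 'I_n.+1) (d g : 'I_n.+1 -> fps).
Variable e : rel 'I_n.+1.
Hypothesis par_lt : forall v, v != ord0 -> (par v < v)%N.
Hypothesis dgK : forall v, v != ord0 -> d v * g v = 1.
Hypothesis dE : forall u,
  d u = 1 - fps_X * (fps_X * \sum_(w | (w != ord0) && (par w == u)) g w).
Hypothesis eE : forall u v,
  e u v = (v != ord0) && (par v == u) || (u != ord0) && (par u == v).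

Let child (u w : 'I_n.+1) : fps := ((w != ord0) && (par w == u))%:R.

(** Eliminating the vertices from the leaves down gives [I - xA = L D L^T] with
    [L] unitriangular and [D] the diagonal matrix of the [d v]. *)
Lemma det_forest : char_series e = \prod_v d v.
Proof.
pose L : 'M[fps]_n.+1 := \matrix_(u, w) ((u == w)%:R - fps_X * g w * child u w).
have par_neq u : u != ord0 -> (par u == u) = false.
  by move=> /par_lt; rewrite ltn_neqAle => /andP[/negPf].
have detL : \det L = 1.
  (* Parents have smaller indices, so [L] is upper triangular and its transpose lower triangular. *)
  rewrite -det_tr det_trig.
    apply: big1 => u _; rewrite !mxE eqxx /child; case: eqVneq => //= [_|u0].
      by rewrite mulr0 subr0.
    by rewrite par_neq // mulr0 subr0.
  apply/is_trig_mxP => u v lt_uv; rewrite !mxE /child.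
  rewrite (gtn_eqF lt_uv : (v == u) = false) sub0r.
  case: (boolP (_ && _)) => [/andP[u0 /eqP pu]|_]; last by rewrite mulr0 oppr0.
  by have := par_lt u0; rewrite pu ltnNge (ltnW lt_uv).
suff -> : char_series e = \det (L *m diag_mx (\row_v d v) *m L^T).
  rewrite !det_mulmx det_tr detL mul1r mulr1 det_diag.
  by apply: eq_bigr => v _; rewrite mxE.
congr (\det _); apply/matrixP => u v; rewrite mul_mx_diag !mxE.
have sum_delta (z : 'I_n.+1) (F : 'I_n.+1 -> fps) : \sum_w (z == w)%:R * F w = F z.
  rewrite (bigD1 z) //= eqxx mul1r big1 ?addr0 // => w /negPf wz.
  by rewrite eq_sym wz mul0r.
transitivity (\sum_w ((u == w)%:R * ((v == w)%:R * d w)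
   + ((u == w)%:R * (- fps_X * child v w) + ((v == w)%:R * (- fps_X * child u w)
   + (fps_X * (fps_X * (child u w * child v w * g w))))))); last first.
  apply: eq_bigr => w _; rewrite !mxE /child.
  have [-> /=|w0] := eqVneq w ord0; first by ring.
  by ring: (dgK w0).
rewrite !big_split /= !sum_delta dE.
have [<-|neq_uv] := eqVneq u v.
  have -> : e u u = false by rewrite eE orbb; case: eqVneq => //= /par_neq.
  have cu : child u u = 0 by rewrite /child; case: eqVneq => //= /par_neq ->.
  rewrite cu -!mulr_sumr (_ : \sum_w child u w * child u w * g w =
    \sum_(w | (w != ord0) && (par w == u)) g w); last first.
    rewrite [RHS]big_mkcond /=; apply: eq_bigr => w _; rewrite /child.
    by case: ifP => _; rewrite ?mul1r ?mul0r.
  by rewrite mulr1n mulr0n; ring.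
(* Distinct [u] and [v] have no common child. *)
rewrite [X in _ = _ + (_ + (_ + X))]big1; last first.
  move=> w _; rewrite /child; case: (w != ord0); rewrite /= ?mul0r ?mulr0 //.
  case: (par w =P u) => [->|_]; last by rewrite !mul0r !mulr0.
  by rewrite (negPf neq_uv) !(mulr0, mul0r).
suff -> : (e u v)%:R = child u v + child v u :> fps by rewrite mulr0n; ring.
rewrite eE /child; case: (boolP (_ && _)) => [/andP[v0 /eqP pv]|_]; last by rewrite add0r.
case: (boolP (_ && _)) => [/andP[u0 /eqP pu]|_]; last by rewrite addr0.
by have := par_lt u0; have := par_lt v0; rewrite pv pu; lia.
Qed.
End Forest.

(** * Starlike trees *)

(** [nth 0 (tails a) v] is the number of vertices on the path from vertex
    [v.+1] of the starlike tree to the end of its branch. *)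
Definition tails (a : seq nat) : seq nat := flatten [seq rev (iota 1 x) | x <- a].

Lemma size_tails (a : seq nat) : size (tails a) = sumn a.
Proof.
rewrite size_flatten /shape -map_comp; congr sumn.
by rewrite -[RHS]map_id; apply: eq_map => x /=; rewrite size_rev size_iota.
Qed.

Lemma branch_starts_cons (x : nat) (a : seq nat) :
  branch_starts (x :: a) = 1%N :: [seq (x + v)%N | v <- branch_starts a].
Proof.
rewrite /branch_starts /= (iotaDl 1 0) -!map_comp.
by congr (_ :: _); apply: eq_map => i /=; rewrite addnA.
Qed.

Lemma nth_tails_cons (x : nat) (a : seq nat) (v : nat) :
  nth 0%N (tails (x :: a)) v =
  if (v < x)%N then (x - v)%N else nth 0%N (tails a) (v - x).
Proof.
rewrite /tails /= nth_cat size_rev size_iota; case: ltnP => // lt_vx.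
by rewrite nth_rev size_iota // nth_iota; lia.
Qed.

Lemma branch_starts_gt0 (a : seq nat) (v : nat) :
  v \in branch_starts a -> (0 < v)%N.
Proof. by move=> /mapP[i _ ->]; rewrite addn1. Qed.

Lemma mem_branch_starts_cons (x v : nat) (a : seq nat) :
  (v \in branch_starts (x :: a)) =
  (v == 1%N) || (x < v)%N && ((v - x)%N \in branch_starts a).
Proof.
rewrite branch_starts_cons inE; congr (_ || _).
apply/mapP/andP => [[u us ->]|[lt_xv us]].
  by rewrite addKn us -[X in (X < _)%N]addn0 ltn_add2l (branch_starts_gt0 us).
by exists (v - x)%N; rewrite // subnKC // ltnW.
Qed.

Lemma mem1_branch_starts (a : seq nat) : (0 < sumn a)%N -> 1%N \in branch_starts a.
Proof. by case: a => // x a _; rewrite mem_branch_starts_cons. Qed.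

Lemma nth_tails_gt0 (a : seq nat) (v : nat) :
  (v < sumn a)%N -> (0 < nth 0%N (tails a) v)%N.
Proof.
elim: a v => //= x a IH v lt_v; rewrite nth_tails_cons.
by case: (ltnP v x) => lt_vx; [rewrite subn_gt0 | apply: IH; lia].
Qed.

(** Position [v] stands for vertex [v.+1], whose only possible child is [v.+2]; the value 0 marks
    the end of a branch. *)
Lemma nth_tailsS (a : seq nat) (v : nat) :
  all (fun x => 0 < x)%N a -> (v < sumn a)%N ->
  (nth 0%N (tails a) v).-1 =
  if (v.+1 < sumn a)%N && (v.+2 \notin branch_starts a)
  then nth 0%N (tails a) v.+1 else 0%N.
Proof.
elim: a v => //= x a IH v /andP[x0 a0] lt_v.
rewrite !nth_tails_cons mem_branch_starts_cons /=.
case: (ltngtP v.+1 x) => [lt_vx|lt_xv|eq_vx].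
- rewrite (ltn_addr _ lt_vx) [(x < v.+2)%N]ltnNge lt_vx /=; lia.
- rewrite (ltnW lt_xv : (x < v.+2)%N) /=.
  rewrite (_ : v.+2 - x = (v - x).+2)%N; last by lia.
  rewrite (_ : v.+1 - x = (v - x).+1)%N; last by lia.
  rewrite IH //; last by lia.
  by rewrite (_ : (v.+1 < x + sumn a) = ((v - x).+1 < sumn a))%N //; lia.
- rewrite -eq_vx ltnSn !subSnn; case: ifP => // /andP[lt_va].
  by rewrite mem1_branch_starts //; lia.
Qed.

(** At the first vertex of a branch the tail is the whole branch, and positive lengths keep the
    starts distinct. *)
Lemma sum_branch_starts (R : nmodType) (a : seq nat) (F : nat -> R) :
  all (fun x => 0 < x)%N a ->
  \sum_(v <- iota 0 (sumn a) | v.+1 \in branch_starts a) F (nth 0%N (tails a) v) =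
  \sum_(x <- a) F x.
Proof.
elim: a => [|x a IH] /=; first by rewrite !big_nil.
move=> /andP[x0 a0]; rewrite iotaD big_cat big_cons add0n; congr (_ + _).
  case: x x0 => // x _; rewrite /= big_cons mem_branch_starts_cons /= nth_tails_cons.
  rewrite /= subn0 big_seq_cond big1 ?addr0 // => v.
  by rewrite mem_iota mem_branch_starts_cons => /andP[]; lia.
have -> : iota x (sumn a) = [seq (x + v)%N | v <- iota 0 (sumn a)].
  by rewrite -iotaDl addn0.
rewrite big_map -IH //.
apply: eq_big => [v|v _].
  by rewrite mem_branch_starts_cons -addnS addKn; case: (_ \in _); lia.
by rewrite nth_tails_cons ltnNge leq_addr addKn.
Qed.

Lemma prod_tails (a : seq nat) :
  \prod_(r <- tails a) (1 - fps_X * (fps_X * path_G r.-1)) = paths_Phi a.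
Proof.
rewrite big_flatten big_map; apply: eq_bigr => x _.
rewrite (perm_big (iota 1 x)) ?perm_rev // (iotaDl 1 0) big_map.
by rewrite /path_Phi -(big_mkord xpredT (fun i => 1 - fps_X * (fps_X * path_G i)))
  /index_iota subn0.
Qed.

Section StarTree.
Variable a : seq nat.
Hypothesis a_gt0 : all (fun x => 0 < x)%N a.
Local Notation n := (sumn a).

Definition star_parent (v : nat) : nat := if v \in branch_starts a then 0 else v.-1.

Lemma star_parent_lt (v : nat) : v != 0%N -> (star_parent v < v)%N.
Proof. by rewrite /star_parent; case: ifP; lia. Qed.

Lemma star_edge0E (u v : nat) : (v <= n)%N ->
  star_edge0 a u v = (v != 0%N) && (star_parent v == u).
Proof.
move=> le_vn; rewrite /star_edge0 /star_parent.
case: (boolP (v \in branch_starts a)) => [vs|v_s].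
  by rewrite !andbF orbF andbT -lt0n (branch_starts_gt0 vs) eq_sym.
rewrite andbF /= andbT.
have v1 : v != 1%N.
  by apply: contraNneq v_s => v1; rewrite v1 mem1_branch_starts // -v1.
by move: v1 {v_s le_vn}; lia.
Qed.

Lemma center_children :
  \sum_(w : 'I_n.+1 | ((w : nat) != 0%N) && (star_parent w == 0%N))
    path_G (nth 0%N (tails a) w.-1) = \sum_(x <- a) path_G x.
Proof.
rewrite -(big_mkord (fun w => (w != 0%N) && (star_parent w == 0%N))
  (fun w => path_G (nth 0%N (tails a) w.-1))).
rewrite /index_iota subn0 /= big_cons /= -(sum_branch_starts path_G a_gt0).
rewrite (iotaDl 1 0) big_map big_seq_cond [RHS]big_seq_cond.
apply: eq_bigl => v; rewrite mem_iota add0n /= add1n /star_parent.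
case: (boolP (v < n)%N) => //= lt_vn; case: ifP => //=.
by case: v lt_vn => //= n0; rewrite mem1_branch_starts.
Qed.

(** The sum has at most one term, for the successor of [u]; at the end of a branch it is empty, in
    agreement with [path_G 0 = 0]. *)
Lemma branch_children (u : nat) : u != 0%N -> (u <= n)%N ->
  \sum_(w : 'I_n.+1 | ((w : nat) != 0%N) && (star_parent w == u))
    path_G (nth 0%N (tails a) w.-1) = path_G (nth 0%N (tails a) u.-1).-1.
Proof.
case: u => // u _ lt_un; rewrite nth_tailsS //.
have pE w : (w != 0%N) && (star_parent w == u.+1) =
    (u.+2 \notin branch_starts a) && (w == u.+2).
  rewrite /star_parent; case: (eqVneq w u.+2) => [->|w_u].
    by case: ifP => //= _; rewrite eqxx.
  by rewrite andbF; case: ifP; lia.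
under eq_bigl do rewrite pE.
case: (boolP (_ \in _)) => [_|_] /=; first by rewrite big_pred0 // andbF.
rewrite andbT; case: ltnP => [lt_u|le_n].
  by rewrite (big_pred1 (Ordinal (lt_u : (u.+2 < n.+1)%N))).
by rewrite big_pred0 // => w; have := ltn_ord w; lia.
Qed.

(** In [det_forest], a branch vertex with tail [r] has pivot [1 - X^2 G_(r-1)], with inverse [G_r]
    by [path_GK]; the pivot of the centre is [center_Phi a]. *)
Lemma char_series_star : char_series (star_rel a) = star_Phi a.
Proof.
pose par (v : 'I_n.+1) : 'I_n.+1 := inord (star_parent v).
have parE v : (par v : nat) = star_parent v.
  by rewrite inordK // /star_parent; have := ltn_ord v; case: ifP; lia.
pose g (v : 'I_n.+1) := path_G (nth 0%N (tails a) v.-1).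
pose d (v : 'I_n.+1) : fps := if v == ord0 then center_Phi a else
  1 - fps_X * (fps_X * path_G (nth 0%N (tails a) v.-1).-1).
have v0E (v : 'I_n.+1) : (v == ord0) = (v == 0%N :> nat) by [].
rewrite (@det_forest _ par d g).
- rewrite big_ord_recl {1}/d eqxx mulrC; congr (_ * _).
  rewrite -prod_tails (big_nth 0%N) size_tails big_mkord.
  by apply: eq_bigr => v _; rewrite /d.
- by move=> v v0; rewrite parE star_parent_lt.
- move=> v v0; rewrite /d /g (negPf v0).
  have : (0 < nth 0%N (tails a) v.-1)%N.
    by apply: nth_tails_gt0; have := ltn_ord v; move: v0; rewrite v0E; lia.
  by case: (nth _ _ _) => // k _; exact: path_GK.
- move=> u; rewrite (eq_bigl (fun w : 'I_n.+1 =>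
    (w != 0%N :> nat) && (star_parent w == u))); last first.
    by move=> w; rewrite -parE.
  rewrite /d /center_Phi.
  case: eqVneq => [->|u0]; first by rewrite center_children.
  by rewrite branch_children // -ltnS.
- move=> u v; rewrite /star_rel !star_edge0E; try by rewrite -ltnS.
  by rewrite -!(inj_eq val_inj) /= !parE.
Qed.
End StarTree.

(** * The shortlex comparison *)

Lemma star_Phi_nseq0 (k : nat) (a : seq nat) :
  star_Phi (nseq k 0%N ++ a) = star_Phi a.
Proof.
elim: k => //= k <-; rewrite /star_Phi /center_Phi paths_Phi_cons big_cons.
by rewrite {1}/path_Phi big_ord0 mul1r add0r.
Qed.

Lemma lex_ltP (a b : seq nat) : size a = size b -> lex_lt a b ->
  exists r c s d t, [/\ a = r ++ c :: s, b = r ++ d :: t & (c < d)%N].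
Proof.
elim: a b => [|x a IH] [|y b] //= [eq_sz] /orP[lt_xy|/andP[/eqP<- lt_ab]].
  by exists [::], x, a, y, b.
have [r [c [s [d [t [-> -> lt_cd]]]]]] := IH b eq_sz lt_ab.
by exists (x :: r), c, s, d, t.
Qed.

Lemma lex_lt_total (a b : seq nat) : size a = size b ->
  [\/ lex_lt a b, a = b | lex_lt b a].
Proof.
elim: a b => [|x a IH] [|y b] //=; first by constructor 2.
move=> [/IH{}IH]; case: (ltngtP x y) => [lt_xy|lt_yx|->] /=.
- by constructor 1.
- by constructor 3.
- by case: IH => [|->|]; [constructor 1 | constructor 2 | constructor 3].
Qed.

Lemma sorted_all_ge (x : nat) (s : seq nat) :
  sorted leq (x :: s) -> all (fun y => x <= y)%N s.
Proof. exact: (order_path_min leq_trans). Qed.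

Lemma log_gt_shortlex (a b : seq nat) :
  sorted leq a -> all (fun x => 0 < x)%N a ->
  sorted leq b -> all (fun x => 0 < x)%N b -> (3 <= size b)%N ->
  sumn a = sumn b -> shortlex_lt a b -> log_gt (star_Phi a) (star_Phi b).
Proof.
move=> sort_a a0 sort_b b0 sz_b eq_sum [lt_sz|[eq_sz lt_ab]].
  (* Padded to the size of [b], the list [a] has minimum 0 while [b] lies above 0; here [r] is
     empty. *)
  rewrite -(star_Phi_nseq0 (size b - size a) a) -[nseq _ _ ++ a]cats0
    -[X in log_gt _ (star_Phi X)]cats0.
  apply: (@log_gt_raise_min 0%N) => //.
  - by rewrite mem_cat mem_nseq subn_gt0 lt_sz.
  - exact/allP.
  - by rewrite size_cat size_nseq subnK // ltnW.
  - by rewrite sumn_cat sumn_nseq mul0n.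
  - by rewrite size_cat size_nseq subnK ?(ltnW lt_sz) // sz_b.
have [r [c [s [d [t [aE bE lt_cd]]]]]] := lex_ltP eq_sz lt_ab.
have catC u : star_Phi (r ++ u) = star_Phi (u ++ r).
  by apply: star_Phi_perm; rewrite perm_catC.
rewrite aE bE (catC (c :: s)) (catC (d :: t)).
have le_cs : all (fun x => c <= x)%N s.
  by apply: sorted_all_ge; move: sort_a; rewrite aE => /cat_sorted2[].
have le_dt : all (fun x => d <= x)%N t.
  by apply: sorted_all_ge; move: sort_b; rewrite bE => /cat_sorted2[].
apply: (@log_gt_raise_min c).
- exact: mem_head.
- by rewrite /= leqnn.
- by rewrite /= lt_cd; apply: sub_all le_dt => x; apply: leq_trans.
- by move: eq_sz; rewrite aE bE !size_cat => /addnI.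
- by move: eq_sum; rewrite aE bE !sumn_cat => /addnI.
(* An empty prefix leaves lists of at least three parts; otherwise the first part of [r] is
   positive. *)
- rewrite aE bE in eq_sz b0 sz_b; case: r {catC aE bE} eq_sz b0 sz_b => [|x r] /= eq_sz.
    by rewrite -eq_sz => _ ->.
  by move=> /andP[-> _] _; rewrite orbT.
Qed.

Lemma walk_lt_shortlex (a b : seq nat) :
  sorted leq a -> all (fun x => 0 < x)%N a ->
  sorted leq b -> all (fun x => 0 < x)%N b -> (3 <= size b)%N ->
  sumn a = sumn b -> shortlex_lt a b -> walk_lt (star_rel a) (star_rel b).
Proof.
move=> sort_a a0 sort_b b0 sz_b eq_sum lt_ab.
apply: walk_lt_char_series => //; rewrite !char_series_star //.
exact: log_gt_shortlex.
Qed.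

Local Close Scope ring_scope.

Theorem theorem1 (n : nat) (a b : seq nat) :
  sorted leq a -> all (fun x => 0 < x) a -> 3 <= size a -> sumn a = n ->
  sorted leq b -> all (fun x => 0 < x) b -> 3 <= size b -> sumn b = n ->
  (walk_lt (star_rel a) (star_rel b) <-> shortlex_lt a b).
Proof.
move=> sort_a a0 sz_a sum_a sort_b b0 sz_b sum_b.
have eq_sum : sumn a = sumn b by rewrite sum_a sum_b.
split=> [[le_ab [k lt_k]]|]; last exact: walk_lt_shortlex.
(* Shortlex is total on sequences, so it remains to exclude [b] before [a] and [a = b]; both
   contradict [lt_k], the former through the direction already proved. *)
have not_ba : ~ shortlex_lt b a.
  move=> /(walk_lt_shortlex sort_b b0 sort_a a0 sz_a (esym eq_sum)) [_ [j lt_j]].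
  by have := le_ab j; rewrite leqNgt lt_j.
case: (ltngtP (size a) (size b)) => [lt_sz|lt_sz|eq_sz]; first by left.
  by case: not_ba; left.
case: (lex_lt_total eq_sz) => [lt_ab|eq_ab|lt_ba]; first by right.
- by move: lt_k; rewrite eq_ab ltnn.
- by case: not_ba; right.
Qed.
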